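(* Let $\mathcal A$ be a category with finite coproducts such that coproduct injections are monomorphic, let $(S,\eta,\mu,S',\sigma,\mu')$ be a completely iterative monad on $\mathcal A$, and let $\mathcal C=(\mathcal A_S)^{op}$ be the dual of its Kleisli category, with pointed endofunctor $\blacktriangleright$ (with point $p$) induced by $S'$ and $\sigma$. For every morphism $f:\blacktriangleright X\times Y\to X$ of $\mathcal C$, i.e. every $f:X\to S(S'X+Y)$ in $\mathcal A$, let $f^\dagger:X\to SY$ be the unique solution of the guarded equation morphism $$\bar f=\mu_{X+Y}\cdot S\mathsf{can}\cdot S(\sigma_X+\eta_Y)\cdot f:X\to S(X+Y),\qquad \mathsf{can}=[S\mathsf{inl},S\mathsf{inr}]:SX+SY\to S(X+Y).$$ Then $f^\dagger$, regarded as a morphism $Y\to X$ in $\mathcal C$, is the unique morphism of $\mathcal C$ satisfying the fixpoint identity $f^\dagger=f\cdot(p_X\times Y)\cdot\langle f^\dagger,Y\rangle$ in $\mathcal C$.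
   Context: Notation: objects also denote their identity morphisms; $g\cdot f$ is composition ($f$ first). Ideal monad on $\mathcal A$: a six-tuple $(S,\eta,\mu,S',\sigma,\mu')$ with $(S,\eta,\mu)$ a monad on $\mathcal A$, $\sigma:S'\hookrightarrow S$ a subfunctor and $\mu':S'S\to S'$ a natural transformation such that $S=S'+\mathrm{Id}$ with coproduct injections $\sigma,\eta$, and $\sigma\cdot\mu'=\mu\cdot\sigma S$. An equation morphism is a morphism $e:X\to S(X+Y)$. A solution of $e$ is a morphism $e^\dagger:X\to SY$ with $e^\dagger=\mu_Y\cdot S[e^\dagger,\eta_Y]\cdot e$. The morphism $e$ is guarded if it factors through $[\sigma_{X+Y},\eta_{X+Y}\cdot\mathsf{inr}]:S'(X+Y)+Y\to S(X+Y)$. The ideal monad is completely iterative if every guarded equation morphism has a unique solution. Structure on $\mathcal C=(\mathcal A_S)^{op}$: the Kleisli category $\mathcal A_S$ has finite coproducts given by those of $\mathcal A$, so $\mathcal C$ has finite products, with $X\times Y$ in $\mathcal C$ being $X+Y$. The functor $S'$ extends to $\mathcal A_S$ by $X\mapsto S'X$ on objects and by sending $f:X\to SY$ to $\eta_{S'Y}\cdot\mu'_Y\cdot S'f:S'X\to SS'Y$; $\blacktriangleright$ is the dual endofunctor of $\mathcal C$. Its point $p:\mathrm{Id}\to\blacktriangleright$ in $\mathcal C$ has components given by $\sigma_X:S'X\to SX$ (a Kleisli morphism from $S'X$ to $X$). The morphism $\bar f$ in the claim is always guarded, so $f^\dagger$ is well defined. *)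

(* Defs.v *)
(** Categories have Leibniz equality on hom-sets.  [g ∘ f] means: [f] first. *)

Set Implicit Arguments.
Unset Strict Implicit.
Unset Printing Implicit Defensive.

Declare Scope cat_scope.
Delimit Scope cat_scope with cat.
Local Open Scope cat_scope.

Reserved Notation "g ∘ f" (at level 40, left associativity).
Reserved Notation "X ⊕ Y" (at level 50, left associativity).
Reserved Notation "X ⊗ Y" (at level 40, left associativity).

Record Category := MkCategory {
  ob :> Type;
  hom : ob -> ob -> Type;
  id : forall X, hom X X;
  comp : forall X Y Z, hom Y Z -> hom X Y -> hom X Z;
  comp_idl : forall X Y (f : hom X Y), comp (id Y) f = f;
  comp_idr : forall X Y (f : hom X Y), comp f (id X) = f;
  comp_assoc : forall X Y Z W (h : hom Z W) (g : hom Y Z) (f : hom X Y),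
    comp h (comp g f) = comp (comp h g) f
}.

Arguments hom : clear implicits.
Arguments hom {c} X Y.
Arguments id {c} X.
Arguments comp {c X Y Z} g f.

Notation "g ∘ f" := (comp g f) : cat_scope.

Definition op (C : Category) : Category :=
  {| ob := ob C;
     hom := fun X Y => @hom C Y X;
     id := fun X => @id C X;
     comp := fun X Y Z g f => @comp C Z Y X f g;
     comp_idl := fun X Y f => comp_idr f;
     comp_idr := fun X Y f => comp_idl f;
     comp_assoc := fun X Y Z W h g f => eq_sym (comp_assoc f g h) |}.

Definition monic (C : Category) (X Y : C) (m : hom X Y) : Prop :=
  forall (Z : C) (f g : hom Z X), m ∘ f = m ∘ g -> f = g.

Record Functor (C D : Category) := MkFunctor {
  fobj :> C -> D;
  fmap : forall X Y : C, hom X Y -> hom (fobj X) (fobj Y);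
  fmap_id : forall X : C, fmap (id X) = id (fobj X);
  fmap_comp : forall (X Y Z : C) (g : hom Y Z) (f : hom X Y),
    fmap (g ∘ f) = fmap g ∘ fmap f
}.

Arguments fmap {C D} F {X Y} f : rename.

Definition opF (C D : Category) (F : Functor C D) : Functor (op C) (op D) :=
  {| fobj := fun X : op C => F X : op D;
     fmap := fun (X Y : op C) (f : hom X Y) => @fmap C D F Y X f;
     fmap_id := fun X => @fmap_id C D F X;
     fmap_comp := fun X Y Z g f => @fmap_comp C D F Z Y X f g |}.

Record PointedEndofunctor (C : Category) := MkPointedEndofunctor {
  pfun :> Functor C C;
  point : forall X : C, hom X (pfun X);
  point_nat : forall (X Y : C) (f : hom X Y),
    point Y ∘ f = fmap pfun f ∘ point X
}.

(** ** Finite coproducts and products *)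

Class FiniteCoproducts (C : Category) := MkFiniteCoproducts {
  initial : C;
  from_initial : forall X : C, hom initial X;
  from_initial_unique : forall (X : C) (f : hom initial X), f = from_initial X;
  coprod : C -> C -> C;
  inl : forall X Y : C, hom X (coprod X Y);
  inr : forall X Y : C, hom Y (coprod X Y);
  copair : forall X Y Z : C, hom X Z -> hom Y Z -> hom (coprod X Y) Z;
  copair_inl : forall (X Y Z : C) (f : hom X Z) (g : hom Y Z),
    copair f g ∘ inl X Y = f;
  copair_inr : forall (X Y Z : C) (f : hom X Z) (g : hom Y Z),
    copair f g ∘ inr X Y = g;
  copair_unique : forall (X Y Z : C) (f : hom X Z) (g : hom Y Z)
    (h : hom (coprod X Y) Z),
    h ∘ inl X Y = f -> h ∘ inr X Y = g -> h = copair f g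
}.

Arguments inl {C _} X Y.
Arguments inr {C _} X Y.
Arguments copair {C _ X Y Z} f g.

Notation "X ⊕ Y" := (coprod X Y) : cat_scope.

Definition coprod_map (C : Category) `{FiniteCoproducts C} (X Y X' Y' : C)
  (f : hom X X') (g : hom Y Y') : hom (X ⊕ Y) (X' ⊕ Y') :=
  copair (inl X' Y' ∘ f) (inr X' Y' ∘ g).

Class FiniteProducts (C : Category) := MkFiniteProducts {
  terminal : C;
  to_terminal : forall X : C, hom X terminal;
  to_terminal_unique : forall (X : C) (f : hom X terminal), f = to_terminal X;
  prod : C -> C -> C;
  outl : forall X Y : C, hom (prod X Y) X;
  outr : forall X Y : C, hom (prod X Y) Y;
  pair : forall X Y Z : C, hom Z X -> hom Z Y -> hom Z (prod X Y);
  outl_pair : forall (X Y Z : C) (f : hom Z X) (g : hom Z Y),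
    outl X Y ∘ pair f g = f;
  outr_pair : forall (X Y Z : C) (f : hom Z X) (g : hom Z Y),
    outr X Y ∘ pair f g = g;
  pair_unique : forall (X Y Z : C) (f : hom Z X) (g : hom Z Y)
    (h : hom Z (prod X Y)),
    outl X Y ∘ h = f -> outr X Y ∘ h = g -> h = pair f g
}.

Arguments outl {C _} X Y.
Arguments outr {C _} X Y.
Arguments pair {C _ X Y Z} f g.

Notation "X ⊗ Y" := (prod X Y) : cat_scope.

Definition prod_map (C : Category) `{FiniteProducts C} (X Y X' Y' : C)
  (f : hom X X') (g : hom Y Y') : hom (X ⊗ Y) (X' ⊗ Y') :=
  pair (f ∘ outl X Y) (g ∘ outr X Y).

Definition op_products (C : Category) (H : FiniteCoproducts C) :
  FiniteProducts (op C) :=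
  @MkFiniteProducts (op C) (@initial C H) (@from_initial C H)
    (@from_initial_unique C H) (@coprod C H) (@inl C H) (@inr C H)
    (fun X Y Z f g => @copair C H X Y Z f g)
    (@copair_inl C H) (@copair_inr C H) (@copair_unique C H).

Definition is_coproduct (C : Category) (X Y P : C)
  (i : hom X P) (j : hom Y P) : Prop :=
  forall (Z : C) (f : hom X Z) (g : hom Y Z),
    exists! h : hom P Z, h ∘ i = f /\ h ∘ j = g.

Definition injections_monic (C : Category) `{FiniteCoproducts C} : Prop :=
  forall X Y : C, monic (inl X Y) /\ monic (inr X Y).

Arguments injections_monic C {_}.

(** ** Monads and ideal monads *)

Record Monad (A : Category) := MkMonad {
  mfun :> Functor A A;
  eta : forall X : A, hom X (mfun X);
  eta_nat : forall (X Y : A) (f : hom X Y),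
    eta Y ∘ f = fmap mfun f ∘ eta X;
  mu : forall X : A, hom (mfun (mfun X)) (mfun X);
  mu_nat : forall (X Y : A) (f : hom X Y),
    mu Y ∘ fmap mfun (fmap mfun f) = fmap mfun f ∘ mu X;
  mu_eta_l : forall X : A, mu X ∘ eta (mfun X) = id (mfun X);
  mu_eta_r : forall X : A, mu X ∘ fmap mfun (eta X) = id (mfun X);
  mu_assoc : forall X : A, mu X ∘ mu (mfun X) = mu X ∘ fmap mfun (mu X)
}.

(** [S = S' + Id] and [sigma : S' >-> S] are stated componentwise: over a base
    with coproducts, coproducts of endofunctors are computed pointwise. *)
Record IdealMonad (A : Category) := MkIdealMonad {
  imonad :> Monad A;
  ideal : Functor A A;
  sigma : forall X : A, hom (ideal X) (imonad X);
  sigma_nat : forall (X Y : A) (f : hom X Y),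
    sigma Y ∘ fmap ideal f = fmap imonad f ∘ sigma X;
  sigma_monic : forall X : A, monic (sigma X);
  mu' : forall X : A, hom (ideal (imonad X)) (ideal X);
  mu'_nat : forall (X Y : A) (f : hom X Y),
    mu' Y ∘ fmap ideal (fmap imonad f) = fmap ideal f ∘ mu' X;
  ideal_coproduct : forall X : A, is_coproduct (sigma X) (eta imonad X);
  sigma_mu' : forall X : A,
    sigma X ∘ mu' X = mu imonad X ∘ sigma (imonad X)
}.

Section Iteration.
Variables (A : Category) (HA : FiniteCoproducts A) (S : IdealMonad A).

Definition is_solution (X Y : A) (e : hom X (S (X ⊕ Y))) (s : hom X (S Y)) :
  Prop :=
  s = mu S Y ∘ fmap S (copair s (eta S Y)) ∘ e.

Definition guarded (X Y : A) (e : hom X (S (X ⊕ Y))) : Prop :=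
  exists u : hom X (ideal S (X ⊕ Y) ⊕ Y),
    e = copair (sigma S (X ⊕ Y)) (eta S (X ⊕ Y) ∘ inr X Y) ∘ u.

Definition completely_iterative : Prop :=
  forall (X Y : A) (e : hom X (S (X ⊕ Y))),
    guarded e -> exists! s : hom X (S Y), is_solution e s.

Definition can (X Y : A) : hom (S X ⊕ S Y) (S (X ⊕ Y)) :=
  copair (fmap S (inl X Y)) (fmap S (inr X Y)).

Definition bar (X Y : A) (f : hom X (S (ideal S X ⊕ Y))) :
  hom X (S (X ⊕ Y)) :=
  mu S (X ⊕ Y) ∘ fmap S (can X Y) ∘
    fmap S (coprod_map (sigma S X) (eta S Y)) ∘ f.

End Iteration.

Arguments completely_iterative {A HA} S.
Arguments can {A HA} S X Y.

(** ** The Kleisli category *)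

Section Kleisli.
Variables (A : Category) (S : Monad A).

Definition kcomp (X Y Z : A) (g : hom Y (S Z)) (f : hom X (S Y)) :
  hom X (S Z) := mu S Z ∘ fmap S g ∘ f.

Lemma kcomp_etal (X Y : A) (f : hom X (S Y)) : kcomp (eta S Y) f = f.
Proof. unfold kcomp; rewrite (mu_eta_r S Y); apply comp_idl. Qed.

Lemma kcomp_etar (X Y : A) (f : hom X (S Y)) : kcomp f (eta S X) = f.
Proof.
unfold kcomp; rewrite <- comp_assoc, <- eta_nat, comp_assoc, mu_eta_l.
apply comp_idl.
Qed.

Lemma kcomp_assoc (X Y Z W : A) (h : hom Z (S W)) (g : hom Y (S Z))
  (f : hom X (S Y)) : kcomp h (kcomp g f) = kcomp (kcomp h g) f.
Proof.
unfold kcomp; rewrite !fmap_comp, !comp_assoc, <- mu_assoc.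
rewrite <- (comp_assoc (mu S W) (fmap S h) (mu S Z)), <- mu_nat, !comp_assoc.
reflexivity.
Qed.

Lemma kcomp_pure (X Y Z : A) (g : hom Y (S Z)) (f : hom X Y) :
  kcomp g (eta S Y ∘ f) = g ∘ f.
Proof.
transitivity (kcomp g (eta S Y) ∘ f).
- unfold kcomp; rewrite !comp_assoc; reflexivity.
- rewrite kcomp_etar; reflexivity.
Qed.

Definition Kleisli : Category :=
  {| ob := ob A;
     hom := fun X Y => @hom A X (S Y);
     id := fun X => eta S X;
     comp := kcomp;
     comp_idl := kcomp_etal;
     comp_idr := kcomp_etar;
     comp_assoc := kcomp_assoc |}.

Definition kleisli_coproducts (HA : FiniteCoproducts A) :
  FiniteCoproducts Kleisli.
Proof.
refine (@MkFiniteCoproducts Kleisli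
  (@initial A HA) (fun X => @from_initial A HA (S X)) _
  (@coprod A HA)
  (fun X Y : A => eta S (X ⊕ Y) ∘ inl X Y)
  (fun X Y : A => eta S (X ⊕ Y) ∘ inr X Y)
  (fun X Y Z f g => @copair A HA X Y (S Z) f g) _ _ _).
- intros X f; apply (@from_initial_unique A HA).
- intros X Y Z f g; simpl; rewrite kcomp_pure; apply copair_inl.
- intros X Y Z f g; simpl; rewrite kcomp_pure; apply copair_inr.
- intros X Y Z f g h; simpl; rewrite !kcomp_pure; apply copair_unique.
Defined.

End Kleisli.

(** ** The pointed endofunctor [▶] on the dual of the Kleisli category *)

Section Later.
Variables (A : Category) (S : IdealMonad A).

Local Notation S' := (ideal S).

Definition ideal_ext (X Y : A) (f : hom X (S Y)) : hom (S' X) (S (S' Y)) :=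
  eta S (S' Y) ∘ (mu' S Y ∘ fmap S' f).

Lemma sigma_mu'_fmap (X Y : A) (f : hom X (S Y)) :
  sigma S Y ∘ (mu' S Y ∘ fmap S' f) = kcomp f (sigma S X).
Proof.
unfold kcomp; rewrite comp_assoc, sigma_mu', <- comp_assoc.
rewrite sigma_nat, comp_assoc; reflexivity.
Qed.

Lemma ideal_ext_id (X : A) : ideal_ext (eta S X) = eta S (S' X).
Proof.
unfold ideal_ext.
enough (H : mu' S X ∘ fmap S' (eta S X) = id (S' X))
  by (rewrite H; apply comp_idr).
apply (@sigma_monic A S X); rewrite sigma_mu'_fmap, comp_idr.
apply kcomp_etal.
Qed.

Lemma ideal_ext_comp (X Y Z : A) (g : hom Y (S Z)) (f : hom X (S Y)) :
  ideal_ext (kcomp g f) = kcomp (ideal_ext g) (ideal_ext f).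
Proof.
unfold ideal_ext at 1 3; rewrite kcomp_pure; unfold ideal_ext.
rewrite <- comp_assoc; apply f_equal.
apply (@sigma_monic A S Z).
rewrite sigma_mu'_fmap, (comp_assoc (sigma S Z)), sigma_mu'_fmap.
unfold kcomp at 3; rewrite <- (comp_assoc _ (sigma S Y)), sigma_mu'_fmap.
symmetry; apply (@kcomp_assoc A S).
Qed.

Definition ideal_kleisli : Functor (Kleisli S) (Kleisli S) :=
  @MkFunctor (Kleisli S) (Kleisli S) (fun X => S' X)
    (fun X Y f => ideal_ext f) ideal_ext_id
    (fun X Y Z g f => ideal_ext_comp g f).

Definition DualKleisli : Category := op (Kleisli S).

#[global] Instance dual_kleisli_products (HA : FiniteCoproducts A) :
  FiniteProducts DualKleisli := op_products (kleisli_coproducts S HA).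

Lemma sigma_point_nat (X Y : Kleisli S) (f : hom X Y) :
  kcomp f (sigma S X) = kcomp (sigma S Y) (ideal_ext f).
Proof. unfold ideal_ext; rewrite kcomp_pure, sigma_mu'_fmap; reflexivity. Qed.

Definition later : PointedEndofunctor DualKleisli :=
  @MkPointedEndofunctor DualKleisli (opF ideal_kleisli)
    (fun X => sigma S X) (fun X Y f => sigma_point_nat f).

End Later.

(* Main.v *)
(** The fixpoint identity in the dual Kleisli category, read in the base
    category, says that [s] is the Kleisli composite of [f], of the morphism
    [[S inl ∘ σ, η ∘ inr] : S'X + Y -> S(X + Y)] and of [[s, η]].  The composite
    of the first two is [bar f], so the fixpoint identity is the equation of a
    solution of [bar f].  Guardedness is checked on the two summands of
    [S(S'X + Y) = S'(S'X + Y) + (S'X + Y)]: on the ideal part use that [S'] is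
    closed under [μ], on the unit part the naturality of [σ]. *)

Require Import Defs.
Local Open Scope cat_scope.

Lemma is_coproduct_hom_ext (A : Category) (X Y P Z : A) (i : hom X P)
  (j : hom Y P) (h k : hom P Z) :
  is_coproduct i j -> h ∘ i = k ∘ i -> h ∘ j = k ∘ j -> h = k.
Proof.
intros HP Ei Ej; destruct (HP Z (k ∘ i) (k ∘ j)) as [m [_ Um]].
transitivity m; [symmetry|]; apply Um; auto.
Qed.

Section Bar.
Variables (A : Category) (HA : FiniteCoproducts A) (S : IdealMonad A).

Definition point_sum (X Y : A) : hom (ideal S X ⊕ Y) (S (X ⊕ Y)) :=
  copair (fmap S (inl X Y) ∘ sigma S X) (eta S (X ⊕ Y) ∘ inr X Y).

Lemma can_coprod_map (X Y : A) :
  can S X Y ∘ coprod_map (sigma S X) (eta S Y) = point_sum X Y.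
Proof.
unfold can, coprod_map, point_sum; apply copair_unique;
  rewrite <- comp_assoc, ?copair_inl, ?copair_inr, comp_assoc,
    ?copair_inl, ?copair_inr.
- reflexivity.
- symmetry; apply eta_nat.
Qed.

Lemma bar_kcomp (X Y : A) (f : hom X (S (ideal S X ⊕ Y))) :
  bar f = kcomp (point_sum X Y) f.
Proof.
unfold bar, kcomp; rewrite <- can_coprod_map, fmap_comp, !comp_assoc.
reflexivity.
Qed.

Lemma prod_map_point (X Y : DualKleisli S) :
  prod_map (point (later S) X) (id Y) = point_sum X Y.
Proof.
cbn; unfold point_sum; f_equal.
- unfold kcomp; rewrite fmap_comp, !comp_assoc, mu_eta_r, comp_idl.
  reflexivity.
- apply kcomp_etar.
Qed.

(** Passing to the dual reverses the left-nested composite, so it is already bracketed as [[s, η]]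
    Kleisli-after [bar f]. *)
Lemma fixpoint_eq_kcomp (X Y : DualKleisli S)
  (f : @hom (DualKleisli S) (later S X ⊗ Y) X) (s : @hom (DualKleisli S) Y X) :
  f ∘ prod_map (point (later S) X) (id Y) ∘ pair s (id Y) =
  mu S Y ∘ fmap S (copair (s : @hom A X (S Y)) (eta S Y)) ∘ @bar A HA S X Y f.
Proof. rewrite prod_map_point, bar_kcomp; reflexivity. Qed.

(** Naturality of [sigma] rewrites [S inl ∘ σ] as [σ ∘ S' inl], which lands in the ideal. *)
Lemma point_sum_guarded (X Y : A) :
  point_sum X Y =
  copair (sigma S (X ⊕ Y)) (eta S (X ⊕ Y) ∘ inr X Y) ∘
    coprod_map (fmap (ideal S) (inl X Y)) (id Y).
Proof.
unfold point_sum, coprod_map; symmetry; apply copair_unique;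
  rewrite <- comp_assoc, ?copair_inl, ?copair_inr, comp_assoc,
    ?copair_inl, ?copair_inr.
- apply sigma_nat.
- apply comp_idr.
Qed.

Lemma bar_guarded (X Y : A) (f : hom X (S (ideal S X ⊕ Y))) : guarded (bar f).
Proof.
set (P := point_sum X Y).
(* [w] factors [μ ∘ S P] through the guard: [μ' ∘ S' P] on the ideal summand, the factor of [P]
   itself on the unit summand. It does not depend on [f]. *)
destruct (ideal_coproduct (i := S) (X := ideal S X ⊕ Y)
  (inl (ideal S (X ⊕ Y)) Y ∘ (mu' S (X ⊕ Y) ∘ fmap (ideal S) P))
  (coprod_map (fmap (ideal S) (inl X Y)) (id Y))) as [w [[Wsigma Weta] _]].
exists (w ∘ f); rewrite bar_kcomp; fold P; unfold kcomp.
rewrite (comp_assoc _ w f); apply (f_equal (fun h => h ∘ f)).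
(* [sigma] and [eta] are jointly epic, so it suffices to compare after each. *)
apply (is_coproduct_hom_ext _ _ _ _ _ _ _ _ _
  (ideal_coproduct (i := S) (X := _))).
- rewrite <- (comp_assoc _ w), Wsigma, comp_assoc, copair_inl.
  symmetry; apply sigma_mu'_fmap.
- rewrite <- (comp_assoc _ w), Weta, <- point_sum_guarded.
  exact (kcomp_etar P).
Qed.

End Bar.

Theorem proposition2p14 (A : Category) (HA : FiniteCoproducts A)
  (Hmono : injections_monic A) (S : IdealMonad A)
  (HS : completely_iterative S) (X Y : DualKleisli S)
  (f : @hom (DualKleisli S) (later S X ⊗ Y) X) :
  guarded (@bar A HA S X Y f) /\
  exists fdag : @hom A X (S Y),
    unique (fun s => is_solution (@bar A HA S X Y f) s) fdag /\
    unique (fun s : @hom (DualKleisli S) Y X =>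
              s = f ∘ prod_map (point (later S) X) (id Y) ∘ pair s (id Y)) fdag.
Proof.
pose proof (bar_guarded A HA S X Y f) as G; split; [exact G|].
destruct (HS _ _ _ G) as [s [Es Us]]; exists s; split; [split; assumption|].
(* Fixpoints and solutions satisfy the same equation, so existence and uniqueness transfer. *)
split; [|intros t Et; apply Us; unfold is_solution].
- rewrite fixpoint_eq_kcomp; exact Es.
- rewrite fixpoint_eq_kcomp in Et; exact Et.
Qed.
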